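(* For $\alpha>0$ and $\beta>0$, let $X_{\alpha,\beta}$ denote a Gamma random variable with probability density function $$f_{\alpha,\beta}(x)=\frac{x^{\alpha-1}e^{-x/\beta}}{\Gamma(\alpha)\beta^\alpha},\qquad x>0.$$ Then for every real $y>0$, $$\inf_{\alpha>0,\,\beta>0}\mathbf{P}\left(|X_{\alpha,\beta}-\mathbf{E}[X_{\alpha,\beta}]|\ge y\sqrt{\mathrm{Var}(X_{\alpha,\beta})}\right)=0.$$
   Context: $\mathbf{P}$, $\mathbf{E}$ and $\mathrm{Var}$ denote probability, expectation and variance; $\Gamma$ is the Euler Gamma function. The density is $0$ outside the indicated range. *)

(* Defs.v *)
From HB Require Import structures.
From mathcomp Require Import all_boot all_order all_algebra.
From mathcomp Require Import all_classical all_reals all_analysis.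

Set Implicit Arguments.
Unset Strict Implicit.
Unset Printing Implicit Defensive.

Import Order.TTheory GRing.Theory Num.Theory.
Import numFieldNormedType.Exports.

Local Open Scope classical_set_scope.
Local Open Scope ring_scope.

Definition Gamma {R : realType} (a : R) : R :=
  \int[lebesgue_measure]_(t in `]0, +oo[) (t `^ (a - 1) * expR (- t)).

(* [b] is the scale (not the rate) parameter. *)
Definition gamma_pdf {R : realType} (a b x : R) : R :=
  if 0 < x then x `^ (a - 1) * expR (- (x / b)) / (Gamma a * b `^ a) else 0.

Definition has_pdf {d : measure_display} {T : measurableType d} {R : realType}
    (P : probability T R) (X : {RV P >-> R}) (f : R -> R) : Prop :=
  forall A : set R, measurable A ->
    distribution P X A = (\int[lebesgue_measure]_(x in A) (f x)%:E)%E.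

(* Main.v *)
Require Import Defs.
From HB Require Import structures.
From mathcomp Require Import all_boot all_order all_algebra.
From mathcomp Require Import all_classical all_reals all_analysis.
From mathcomp Require Import measurable_realfun.
From mathcomp Require Import ring lra.

Set Implicit Arguments.
Unset Strict Implicit.
Unset Printing Implicit Defensive.

Import Order.TTheory GRing.Theory Num.Theory.
Import numFieldNormedType.Exports.

Local Open Scope classical_set_scope.
Local Open Scope ring_scope.

(** Let X be Gamma distributed with shape [a] and scale 1.  Its mean and its
    variance both equal [a], so as [a] tends to 0 the standard deviation
    dominates the mean: once [y * sqrt a > a], a deviation of at least
    [y * sqrt a] must be an upward one, and Markov's inequality bounds its
    probability by [a / (y * sqrt a) = sqrt a / y], which tends to 0.  Since
    probabilities are nonnegative, the infimum is 0.

    The argument tolerates constant factors in the moments, so the recursion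
    [Gamma (a + 1) = a * Gamma a] is replaced by two inequalities that need no
    integration by parts.  That every Gamma density has mass 1 says that
    [t `^ (a - 1) * expR (- (t / b))] has integral [Gamma a * b `^ a] over the
    positive half-line ([gamma_kernel_normalised]).  Integrating the tangent
    line inequality [expR (- (t / b)) >= expR (- t) * (1 + (1 - b^-1) * t)]
    against [t `^ (a - 1)] ([Gamma_rescale_ge]) therefore gives
    [Gamma a + (1 - b^-1) * Gamma (a + 1) <= Gamma a * b `^ a].
    The case [b = 2] shows that the mean [m] is at most [2 * (2 `^ a - 1)],
    which is at most [4 * a] when [a] is small; the case [b = 1/2] with shape
    [a + 1] shows that the second moment is at least [m / 2], so that the
    variance is at least [m / 2 - m ^+ 2 >= m / 4].  These are the moment
    bounds from which [deviation_small_mean] derives the tail estimate. *)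

(** * Integration against a density *)

(** A density agrees almost everywhere with the Radon-Nikodym derivative, for
    which the change of variables formula is known. *)
Lemma ge0_integral_density d (T : measurableType d) (R : realType)
    (nu : {finite_measure set T -> \bar R})
    (mu : {sigma_finite_measure set T -> \bar R}) (f g : T -> \bar R) :
  measurable_fun setT f -> (forall x, 0 <= f x)%E ->
  (forall A, measurable A -> nu A = \int[mu]_(x in A) f x)%E ->
  measurable_fun setT g -> (forall x, 0 <= g x)%E ->
  (\int[nu]_x g x = \int[mu]_x (g x * f x))%E.
Proof.
move=> mf f0 nuE mg g0.
have numu : nu `<< mu.
  apply/null_content_dominatesP => A mA muA0.
  by rewrite nuE// null_set_integral//; exact: measurable_funTS.
rewrite -(Radon_Nikodym_SigmaFinite.change_of_variables numu)//.
set h := Radon_Nikodym_SigmaFinite.f nu mu.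
have ih : mu.-integrable setT h.
  exact: Radon_Nikodym_SigmaFinite.f_integrable.
have mh : measurable_fun setT h by exact: measurable_int ih.
apply: ae_eq_integral => //; [exact: emeasurable_funM|exact: emeasurable_funM|].
apply: ae_eqe_mul2l; apply: integral_ae_eq => // E _ mE.
by rewrite -Radon_Nikodym_SigmaFinite.f_integral// nuE.
Qed.

(** * The Gamma integrals *)

Lemma measurable_gamma_pdf (R : realType) (a b : R) :
  measurable_fun setT (gamma_pdf a b).
Proof.
rewrite /gamma_pdf; apply: measurable_fun_ifT => //.
  exact: measurable_fun_ltr.
apply: measurable_funM => //; apply: measurable_funM => //.
apply: measurableT_comp => //; apply: measurableT_comp => //.
exact: measurable_funM.
Qed.

Lemma Gamma_ge0 (R : realType) (a : R) : 0 <= Gamma a.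
Proof.
by apply: Rintegral_ge0 => x _; rewrite mulr_ge0 ?powR_ge0 ?expR_ge0.
Qed.

Lemma gamma_pdf_ge0 (R : realType) (a b x : R) : 0 <= gamma_pdf a b x.
Proof.
rewrite /gamma_pdf; case: ifP => // _.
by rewrite !(mulr_ge0, invr_ge0, powR_ge0, expR_ge0, Gamma_ge0).
Qed.

Definition gamma_kernel {R : realType} (a b t : R) : R :=
  t `^ (a - 1) * expR (- (t / b)).

Lemma gamma_kernel_ge0 (R : realType) (a b t : R) : 0 <= gamma_kernel a b t.
Proof. by rewrite mulr_ge0 ?powR_ge0 ?expR_ge0. Qed.

Lemma measurable_gamma_kernel (R : realType) (a b : R) (D : set R) :
  measurable_fun D (gamma_kernel a b).
Proof.
apply: measurable_funTS; apply: measurable_funM => //.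
apply: measurableT_comp => //; apply: measurableT_comp => //.
exact: measurable_funM.
Qed.

(** * Moments of a Gamma random variable *)

Section moments.
Context d (T : measurableType d) (R : realType) (P : probability T R).
Context (X : {RV P >-> R}) (a b : R).
Context (hX : has_pdf X (gamma_pdf a b)).

Let mu := @lebesgue_measure R.

Lemma gamma_expectation_ge0 (g : R -> R) :
  measurable_fun setT g -> (forall x, 0 <= g x) ->
  (\int[P]_w (g (X w))%:E =
   \int[mu]_(t in `]0%R, +oo[) (g t * gamma_kernel a b t)%:E
     * ((Gamma a * b `^ a)^-1)%:E)%E.
Proof.
move=> mg g0.
(* The Lebesgue measure lives on [measurableTypeR R], whose measurable sets are
   those of [R] under another display; [Y] is [X] with values in that type. *)
pose Y : {mfun T >-> measurableTypeR R} := HB.pack (X : T -> measurableTypeR R)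
  (isMeasurableFun.Build _ _ T (measurableTypeR R) X (measurable_funPT X)).
transitivity (\int[distribution P Y]_x (g x)%:E)%E.
  by rewrite ge0_integral_distribution//; exact/measurable_EFinP.
rewrite (@ge0_integral_density _ _ _ (distribution P Y) lebesgue_measure
  (EFin \o gamma_pdf a b))//.
- rewrite -ge0_integralZr//; first last.
  + by rewrite lee_fin invr_ge0 mulr_ge0 ?Gamma_ge0 ?powR_ge0.
  + by move=> x _; rewrite lee_fin mulr_ge0 ?gamma_kernel_ge0.
  + apply/measurable_EFinP; apply: measurable_funM.
      exact: measurable_funTS.
    exact: measurable_gamma_kernel.
  rewrite [RHS]integral_mkcond; apply: eq_integral => x _.
  rewrite patchE/= mem_setE in_itv/= andbT /gamma_pdf; case: ifP => _.
    by rewrite -!EFinM mulrA.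
  by rewrite mule0.
- by apply/measurable_EFinP; exact: measurable_gamma_pdf.
- by move=> x; rewrite lee_fin gamma_pdf_ge0.
- exact/measurable_EFinP.
Qed.

(** If the constant [Gamma a * b `^ a] were 0, the density would vanish
    identically, as [0^-1 = 0]; this covers a divergent Gamma integral, whose
    real value is 0.  Otherwise the equation [mass = 1] determines the integral,
    and in particular shows that it converges. *)
Lemma gamma_kernel_normalised :
  [/\ 0 < Gamma a,
      mu.-integrable `]0, +oo[ (EFin \o gamma_kernel a b) &
      \int[mu]_(t in `]0, +oo[) gamma_kernel a b t = Gamma a * b `^ a].
Proof.
have := @gamma_expectation_ge0 (cst 1) (measurable_cst _) (fun=> ler01).
rewrite [LHS](_ : _ = 1%E); last first.
  by rewrite /= integral_cst// mul1e; exact: probability_setT.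
under eq_integral do rewrite /= mul1r.
set I := (\int[mu]_(t in _) _)%E; set c := Gamma a * b `^ a => Ic.
have c0 : c != 0.
  apply/eqP => c0; move: Ic; rewrite c0 invr0 mule0 => /eqP.
  by rewrite onee_eq0.
have c_gt0 : 0 < c by rewrite lt_def c0 mulr_ge0 ?Gamma_ge0 ?powR_ge0.
have IE : I = c%:E.
  have -> : I = (I * (c^-1)%:E * c%:E)%E.
    by rewrite -muleA -EFinM mulVf// mule1.
  by rewrite -Ic mul1e.
split.
- rewrite lt_def Gamma_ge0 andbT; apply: contraNneq c0.
  by rewrite /c => ->; rewrite mul0r.
- apply/integrableP; split.
    by apply/measurable_EFinP; exact: measurable_gamma_kernel.
  under eq_integral do rewrite /= ger0_norm ?gamma_kernel_ge0//.
  by rewrite -/I IE ltry.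
- by rewrite /Rintegral -/I IE.
Qed.

(** Multiplying the density by [t ^+ k] only shifts the shape parameter. *)
Lemma gamma_abs_moment k :
    mu.-integrable `]0, +oo[ (EFin \o gamma_kernel (a + k%:R) b) ->
  (\int[P]_w (`|X w| ^+ k)%:E =
   (\int[mu]_(t in `]0%R, +oo[) gamma_kernel (a + k%:R) b t
      / (Gamma a * b `^ a))%R%:E)%E.
Proof.
move=> ik; rewrite (@gamma_expectation_ge0 (fun x => `|x| ^+ k))//; last first.
  exact: measurable_funX.
rewrite EFinM; congr (_ * _)%E.
rewrite /Rintegral fineK; last exact: integrable_fin_num.
apply: eq_integral => t; rewrite inE/= in_itv/= andbT => t0.
rewrite ger0_norm ?ltW// /gamma_kernel mulrA -powR_mulrn ?ltW//.
by rewrite -powRD ?(gt_eqF t0) ?implybT// addrCA addrA.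
Qed.

Lemma gamma_gt0_as : P [set w | X w <= 0] = 0%E.
Proof.
rewrite [LHS](_ : _ = distribution P X `]-oo, 0]); last first.
  by congr (P _); apply/seteqP; split => w; rewrite /= in_itv.
rewrite hX// integral0_eq// => x; rewrite /= in_itv/= => x0.
by rewrite /gamma_pdf ltNge x0.
Qed.

End moments.

(** This is the integrated form of [1 + x <= expR x] at [x = (1 - b^-1) * t]:
    the factor [t] raises the shape by one.  Dividing by [b - 1] and letting [b]
    tend to 1 from either side would yield [Gamma (a + 1) = a * Gamma a]. *)
Lemma Gamma_rescale_ge (R : realType) (a b : R) : 0 < b ->
    let mu := @lebesgue_measure R in
    mu.-integrable `]0, +oo[ (EFin \o gamma_kernel a b) ->
    mu.-integrable `]0, +oo[ (EFin \o gamma_kernel a 1) ->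
    mu.-integrable `]0, +oo[ (EFin \o gamma_kernel (a + 1) 1) ->
  \int[mu]_(t in `]0, +oo[) gamma_kernel a 1 t
    + (1 - b^-1) * \int[mu]_(t in `]0, +oo[) gamma_kernel (a + 1) 1 t
  <= \int[mu]_(t in `]0, +oo[) gamma_kernel a b t.
Proof.
move=> b0 mu ib i1 iS.
have iZ : mu.-integrable `]0, +oo[
    (EFin \o (fun t => (1 - b^-1) * gamma_kernel (a + 1) 1 t)).
  by apply: eq_integrable (integrableZl _ (1 - b^-1) iS).
rewrite -RintegralZl// -RintegralD//; apply: le_Rintegral => //.
  by apply: eq_integrable (integrableD _ i1 iZ).
move=> t; rewrite /= in_itv/= andbT => t0.
have -> : gamma_kernel (a + 1) 1 t = t * gamma_kernel a 1 t.
  have tE : t `^ (a + 1 - 1) = t * t `^ (a - 1).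
    rewrite -[X in X * _]powRr1 ?ltW// -powRD ?(gt_eqF t0) ?implybT//.
    by congr (t `^ _); ring.
  by rewrite /gamma_kernel tE mulrA.
rewrite /gamma_kernel divr1.
have -> : expR (- (t / b)) = expR (- t) * expR ((1 - b^-1) * t).
  by rewrite -expRD; congr expR; ring.
have := expR_ge1Dx ((1 - b^-1) * t).
have : 0 <= t `^ (a - 1) * expR (- t) by rewrite mulr_ge0 ?powR_ge0 ?expR_ge0.
set u := t `^ _ * _ => u0 h.
rewrite mulrA -/u mulrA -[X in X + _]mulr1 [X in _ + X]mulrC -mulrDr.
exact: ler_wpM2l.
Qed.

(** * The tail estimate *)

(** Since [m <= 2 * q] and [4 * m <= 1], the standard deviation [s] is at least
    [Num.sqrt m / 2], so for small [m] the deviation [y * s] exceeds the mean.  A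
    positive variable can then only deviate upwards, and by Markov's inequality
    it reaches [y * s] with probability at most
    [m / (y * s) <= 2 * Num.sqrt m / y]. *)
Lemma deviation_small_mean d (T : measurableType d) (R : realType)
    (P : probability T R) (X : {RV P >-> R}) (m q y e : R) :
  P [set w | X w <= 0] = 0%E ->
  (\int[P]_w (`|X w|)%:E = m%:E)%E ->
  (\int[P]_w (`|X w| ^+ 2)%:E = q%:E)%E ->
  0 < y -> 0 < e -> 0 < m -> m <= 2 * q ->
  4 * m <= 1 -> 4 * m < y ^+ 2 -> 4 * m <= (e * y) ^+ 2 ->
  (P [set w | (`|X w - fine ('E_P[X]%E)| >=
               y * Num.sqrt (fine ('V_P[X]%E)))%R] <= e%:E)%E.
Proof.
move=> X0 EX EX2 y0 e0 m0 mq m4 my mye.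
have mX : measurable_fun setT X by [].
have iX : P.-integrable setT (EFin \o X).
  apply/integrableP; split; first exact/measurable_EFinP.
  by under eq_integral do rewrite /=; rewrite EX ltry.
have iX2 : P.-integrable setT (EFin \o (X * X)).
  apply/integrableP; split.
    by apply/measurable_EFinP; exact: measurable_funM.
  under eq_integral do rewrite /= normrM -expr2; by rewrite EX2 ltry.
have Em : 'E_P[X]%E = m%:E.
  rewrite expectation_def -EX; apply: ae_eq_integral => //.
  - exact/measurable_EFinP.
  - by apply/measurable_EFinP; exact: measurableT_comp.
  - exists [set w | X w <= 0]; split => //.
      by rewrite -[X in measurable X]setTI; exact: measurable_fun_le.
    move=> w /= h; rewrite leNgt; apply/negP => w0; apply: h => _.
    by rewrite /= gtr0_norm.
have Vm : 'V_P[X]%E = (q - m ^+ 2)%:E.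
  rewrite /variance covarianceE; try exact/Lfun1_integrable.
  rewrite Em -EFinM EFinB expr2 [in LHS]unlock -EX2; congr (_ - _)%E.
  by apply: eq_integral => w _; rewrite /= real_normK ?num_real// expr2.
rewrite Em Vm /=; set s := Num.sqrt _.
have v0 : m / 4 <= q - m ^+ 2 by nra.
have s2 : s ^+ 2 = q - m ^+ 2 by rewrite sqr_sqrtr//; lra.
have s0 : 0 < s by rewrite sqrtr_gt0; lra.
have ys0 : 0 < y * s by rewrite mulr_gt0.
have mys : m < y * s.
  rewrite -ltr_sqr ?nnegrE ?(ltW m0) ?(ltW ys0)// exprMn s2.
  apply: (@lt_le_trans _ _ (y ^+ 2 * (m / 4))); last first.
    by rewrite ler_wpM2l ?sqr_ge0.
  by nra.
have meys : m <= e * (y * s).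
  have eys0 : 0 <= e * (y * s) by rewrite mulr_ge0 ?ltW.
  rewrite -ler_sqr ?nnegrE ?(ltW m0)//.
  rewrite mulrA exprMn s2.
  apply: (@le_trans _ _ ((e * y) ^+ 2 * (m / 4))); last first.
    by rewrite ler_wpM2l ?sqr_ge0.
  by nra.
have mA : measurable [set w | X w <= 0].
  by rewrite -[X in measurable X]setTI; exact: measurable_fun_le.
have mB : measurable [set w | y * s <= `|X w|].
  rewrite -[X in measurable X]setTI; apply: measurable_fun_le => //.
  exact: measurableT_comp.
(* As [m < y * s], a deviation by [y * s] below [m] would make X negative. *)
apply: (@le_trans _ _ (P ([set w | X w <= 0] `|` [set w | y * s <= `|X w|]))).
  apply: le_measure; rewrite ?inE.
  - rewrite -[X in measurable X]setTI; apply: measurable_fun_le => //.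
    by apply: measurableT_comp => //; exact: measurable_funB.
  - exact: measurableU.
  - move=> w /=; have [w0|w0] := leP (X w) 0; [by left|right].
    rewrite gtr0_norm//; move: H.
    by rewrite ler_normr => /orP[]; lra.
apply: (@le_trans _ _ (0 + P [set w | (y * s <= `|X w|)%R])%E).
  by rewrite -X0; exact: measureU2.
rewrite add0e.
have := @markov _ _ _ P X idfun _ ys0 (@measurable_id _ _ _)
  (fun _ => id) (fun _ _ _ _ => id).
rewrite /= unlock EX => h.
have : ((y * s)%:E * P [set w | (y * s <= `|X w|)%R] <= (y * s)%:E * e%:E)%E.
  apply: (le_trans h); by rewrite -EFinM lee_fin mulrC.
by rewrite lee_pmul2l.
Qed.

(** * Letting the shape tend to 0 *)

(** [2 `^ a <= expR a <= (1 - a)^-1], and [(1 - a)^-1 - 1 <= 2 * a] when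
    [a <= 1/2]. *)
Lemma powR2_sub1_le (R : realType) (a : R) : 0 <= a -> 2 * a <= 1 ->
  2 `^ a - 1 <= 2 * a.
Proof.
move=> a0 a1.
have h1 : 2 `^ a <= expR a.
  rewrite /powR pnatr_eq0/= ler_expR ler_piMr//.
  by rewrite -[leRHS]expRK ler_ln ?posrE ?expR_gt0//
    (le_trans _ (expR_ge1Dx 1)).
have h2 : (1 - a) * expR a <= 1.
  rewrite -[leRHS](expRxMexpNx_1 a) mulrC ler_wpM2l ?expR_ge0//.
  by rewrite (le_trans _ (expR_ge1Dx _)).
have : 0 < expR a by exact: expR_gt0.
by nra.
Qed.

Theorem proposition3p5 (R : realType)
    (d : R -> R -> measure_display)
    (T : forall alpha beta : R, measurableType (d alpha beta))
    (P : forall alpha beta : R, probability (T alpha beta) R)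
    (X : forall alpha beta : R, {RV (P alpha beta) >-> R})
    (hX : forall alpha beta : R, 0 < alpha -> 0 < beta ->
      has_pdf (X alpha beta) (gamma_pdf alpha beta))
    (y : R) (hy : 0 < y) :
  ereal_inf [set p : \bar R | exists alpha beta : R,
    [/\ 0 < alpha, 0 < beta &
      p = P alpha beta
        [set w | `|X alpha beta w - fine ('E_(P alpha beta)[X alpha beta])|
                 >= y * Num.sqrt (fine ('V_(P alpha beta)[X alpha beta]))]]]
  = 0%E.
Proof.
have N (a b : R) (a0 : 0 < a) (b0 : 0 < b) :=
  gamma_kernel_normalised (hX a b a0 b0).
have I1 (a : R) (a0 : 0 < a) :
    \int[lebesgue_measure]_(t in `]0, +oo[) gamma_kernel a 1 t = Gamma a.
  by have [_ _ ->] := N a 1 a0 ltr01; rewrite powR1 mulr1.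
have Gb (a b : R) : 0 < a -> 0 < b ->
    Gamma a + (1 - b^-1) * Gamma (a + 1) <= Gamma a * b `^ a.
  move=> a0 b0; have aS0 : 0 < a + 1 by rewrite addr_gt0.
  have [_ ib <-] := N a b a0 b0.
  have [_ i1 _] := N a 1 a0 ltr01.
  have [_ iS _] := N (a + 1) 1 aS0 ltr01.
  by rewrite -{1}(I1 a a0) -(I1 (a + 1) aS0); exact: Gamma_rescale_ge.
apply/eqP; rewrite eq_le; apply/andP; split; last first.
  by apply: le_ereal_inf_tmp => _ [a [b [_ _ ->]]]; exact: measure_ge0.
apply/lee_addgt0Pr => e e0; rewrite add0e.
(* The mean will be at most [4 * a]; the three bounds make it satisfy the three
   smallness conditions of [deviation_small_mean]. *)
pose a : R := Num.min (16^-1) (Num.min (y ^+ 2 / 32) ((e * y) ^+ 2 / 16)).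
have y2 : 0 < y ^+ 2 by rewrite exprn_gt0.
have ey2 : 0 < (e * y) ^+ 2 by rewrite exprn_gt0// mulr_gt0.
have a0 : 0 < a.
  by rewrite !lt_min invr_gt0 ltr0n/=; apply/andP; split; apply: divr_gt0.
have [a16 ay aey] : [/\ a <= 16^-1, a <= y ^+ 2 / 32 & a <= (e * y) ^+ 2 / 16].
  by split; rewrite /a !ge_min lexx ?orbT.
have a10 : 0 < a + 1 by rewrite addr_gt0.
have a20 : 0 < a + 2 by rewrite addr_gt0.
have [G0 _ _] := N a 1 a0 ltr01.
have [G1 _ _] := N (a + 1) 1 a10 ltr01.
have [G2 _ _] := N (a + 2) 1 a20 ltr01.
have M k : 0 < a + k%:R ->
    (\int[P a 1%R]_w (`|X a 1 w| ^+ k)%:E = (Gamma (a + k%:R) / Gamma a)%:E)%E.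
  move=> ak0; have [_ ik _] := N (a + k%:R) 1 ak0 ltr01.
  by rewrite (gamma_abs_moment (hX a 1 a0 ltr01) ik) (I1 _ ak0) powR1 mulr1.
have G1_le : Gamma (a + 1) <= 4 * a * Gamma a.
  have a2 : 2 * a <= 1 by lra.
  have := Gb a 2 a0 (ltr0Sn _ 1).
  have := ler_wpM2r (ltW G0) (powR2_sub1_le (ltW a0) a2).
  lra.
have G2_ge : Gamma (a + 1) <= 2 * Gamma (a + 2).
  have a12 : a + 1 + 1 = a + 2 by ring.
  have h : 2^-1 `^ (a + 1) <= (2^-1 : R).
    by apply: ge1r_powR; lra.
  have := Gb (a + 1) 2^-1 a10 ltac:(by rewrite invr_gt0); rewrite invrK a12.
  have := ler_wpM2l (ltW G1) h.
  lra.
apply: (le_trans (ereal_inf_lbound _)); first by exists a, 1; split.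
apply: (@deviation_small_mean _ _ _ _ _ (Gamma (a + 1) / Gamma a)
  (Gamma (a + 2) / Gamma a)) => //.
- exact: gamma_gt0_as (hX a 1 a0 ltr01).
- exact: (M 1%N a10).
- exact: (M 2%N a20).
- exact: divr_gt0.
- by rewrite mulrA ler_pM2r ?invr_gt0.
- by rewrite mulrA ler_pdivrMr// mul1r; nra.
- by rewrite mulrA ltr_pdivrMr//; nra.
- by rewrite mulrA ler_pdivrMr//; nra.
Qed.
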